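(* Let $\Omega=\sum_{i=0}^{p-2}\sigma_\mu^i(\omega)\in O_S$. Then $M=\mathbb{Q}(\Omega)$ is a subfield of $S$ with $[M:\mathbb{Q}]=p$, $[S:M]=p-1$, and $\sigma_\mu(\Omega)=\Omega$.
   Context: $p$ is an odd prime, $\zeta$ a primitive $p$-th root of unity, $K=\mathbb{Q}(\zeta)$, $O_K$ its ring of integers, $K^+$ its maximal real subfield with unit group $O_{K^+}^*$, $\lambda=\zeta-1$, $\pi=\lambda O_K$. $v$ is a fixed primitive root mod $p$, $\sigma$ the automorphism of $K$ with $\sigma(\zeta)=\zeta^v$. $C_p$ is the group of ideal classes of $K$ of order dividing $p$, $C_p^\pm$ its subgroups of classes fixed/inverted by complex conjugation. For $A$ with $v_\pi(A)=0$: semi-primary means $A\equiv a\pmod{\pi^2}$ for some rational integer $a$. $A\in O_K$ is singular if $A^{1/p}\notin K$ and $AO_K=\mathfrak a^p$. Let $1\le\mu\le p-1$. Singular data: (negative) $\Gamma\subset C_p^-$ of order $p$ annihilated by $\sigma-\mu$, $A$ singular semi-primary with $AO_K=\mathfrak a^p$, $\mathfrak a$ non-principal, $Cl(\mathfrak a)\in\Gamma$, $Cl(\mathfrak a)^{\sigma-\mu}=1$, $\sigma(A)=A^\mu\alpha^p$ ($\alpha\in K$), $\mu\equiv v^{2m+1}$, $1\le m\le(p-3)/2$, $\pi^{2m+1}\mid A-a^p$ for an integer $1\le a\le p-1$; (positive) the same with $\Gamma\subset C_p^+$, $\mu\equiv v^{2m}$, $\pi^{2m}\mid A-a^p$; (unit)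 $A\in O_{K^+}^*$ semi-primary with $A^{1/p}\notin K$, $\sigma(A)=A^\mu\alpha^p$ ($\alpha\in O_{K^+}^*$), $\mu\equiv v^{2m}$, $1\le m\le(p-3)/2$, $\pi^{2m}\mid A-a^p$. Let $\omega=A^{(p-1)/p}$ (a fixed $p$-th root of $A^{p-1}$) and $S=K(\omega)$, Galois over $\mathbb{Q}$ of degree $p(p-1)$. The $p$ automorphisms of $S$ extending $\sigma$ are $\sigma_{(w)}$, $w=0,\dots,p-1$, with $\sigma_{(w)}(\omega)=\omega^\mu\alpha^{p-1}\zeta^w$; $\sigma_\mu$ denotes the unique $\sigma_{(w)}$ for which $\alpha^{p-1}\zeta^w\equiv 1\pmod{\pi^2}$. *)

(* Defs.v *)
From HB Require Import structures.
From mathcomp Require Import all_boot all_order all_algebra all_fingroup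
  all_solvable all_field.
From mathcomp Require Import boolp classical_sets functions cardinality.
Set Implicit Arguments.
Unset Strict Implicit.
Unset Printing Implicit Defensive.
Import Order.TTheory GRing.Theory Num.Theory.
Local Open Scope classical_set_scope.
Local Open Scope card_scope.
Local Open Scope ring_scope.

(* All number fields are subfields of an ambient normal number field L, which
   is embedded in the algebraic complex numbers by iota so that "real" and
   "complex conjugation" make sense. *)

Definition ring_of_integers (L : fieldExtType rat) (E : {subfield L}) : set L :=
  [set x | x \in E /\ integralOver (intr : int -> L) x].

Record is_ideal (L : fieldExtType rat) (E : {subfield L}) (I : set L) : Prop :=
  IsIdeal {
    ideal_sub : I `<=` ring_of_integers E;
    ideal_neq0 : exists2 x, I x & x != 0;
    ideal_add : forall x y, I x -> I y -> I (x + y);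
    ideal_mull : forall r x, ring_of_integers E r -> I x -> I (r * x)
  }.

Definition principal_ideal (L : fieldExtType rat) (E : {subfield L}) (x : L)
  : set L := [set x * r | r in ring_of_integers E].

Definition ideal_mul (L : fieldExtType rat) (I J : set L) : set L :=
  [set x | exists n (a b : 'I_n -> L),
     [/\ forall i, I (a i), forall i, J (b i) & x = \sum_(i < n) a i * b i]].

Definition ideal_exp (L : fieldExtType rat) (E : {subfield L}) (I : set L)
  (n : nat) : set L := iter n (ideal_mul I) (ring_of_integers E).

(* v_P(x) >= n for x in E, not necessarily integral: clear the denominator by
   an integer prime to the prime ideal P. *)
Definition val_ge (L : fieldExtType rat) (E : {subfield L}) (P : set L)
  (n : nat) (x : L) : Prop :=
  exists2 b, ring_of_integers E b /\ ~ P b & ideal_exp E P n (b * x).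

Definition val_eq0 (L : fieldExtType rat) (E : {subfield L}) (P : set L)
  (x : L) : Prop := val_ge E P 0 x /\ ~ val_ge E P 1 x.

(* x = y mod P^n, in the local ring of E at P *)
Definition eqmod_ideal (L : fieldExtType rat) (E : {subfield L}) (P : set L)
  (n : nat) (x y : L) : Prop := val_ge E P n (x - y).

(* A class is the set of the nonzero integral ideals in it. *)
Definition ideal_equiv (L : fieldExtType rat) (E : {subfield L})
  (I J : set L) : Prop :=
  exists x y, [/\ ring_of_integers E x, x != 0, ring_of_integers E y, y != 0
    & [set x * z | z in I] = [set y * z | z in J]].

Definition ideal_class (L : fieldExtType rat) (E : {subfield L}) (I : set L)
  : set (set L) := [set J | is_ideal E J /\ ideal_equiv E I J].

Definition class_set (L : fieldExtType rat) (E : {subfield L})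
  : set (set (set L)) := [set ideal_class E I | I in is_ideal E].

Definition class_one (L : fieldExtType rat) (E : {subfield L}) : set (set L) :=
  ideal_class E (ring_of_integers E).

Definition class_mul (L : fieldExtType rat) (E : {subfield L})
  (c d : set (set L)) : set (set L) :=
  [set J | is_ideal E J /\
     exists I1 I2, [/\ c I1, d I2 & ideal_equiv E (ideal_mul I1 I2) J]].

Definition class_exp (L : fieldExtType rat) (E : {subfield L})
  (c : set (set L)) (n : nat) : set (set L) :=
  iter n (class_mul E c) (class_one E).

Record is_class_subgroup (L : fieldExtType rat) (E : {subfield L})
  (G : set (set (set L))) : Prop := IsClassSubgroup {
    class_subgroup_sub : G `<=` class_set E;
    class_subgroup1 : G (class_one E);
    class_subgroupM : forall c d, G c -> G d -> G (class_mul E c d);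
    class_subgroupV :
      forall c, G c -> exists2 d, G d & class_mul E c d = class_one E
  }.

Definition class_image (L : fieldExtType rat) (s : L -> L)
  (c : set (set L)) : set (set L) := [set s @` I | I in c].

Definition ideal_conj (L : fieldExtType rat) (iota : {rmorphism L -> algC})
  (I : set L) : set L := [set y | exists2 x, I x & iota y = (iota x)^*].

Definition class_conj (L : fieldExtType rat) (iota : {rmorphism L -> algC})
  (c : set (set L)) : set (set L) := [set ideal_conj iota I | I in c].

Definition max_real_subfield (L : fieldExtType rat)
  (iota : {rmorphism L -> algC}) (E : {subfield L}) : set L :=
  [set x | x \in E /\ iota x \is Num.real].

Definition real_units (L : fieldExtType rat) (iota : {rmorphism L -> algC})
  (E : {subfield L}) : set L :=
  [set x | [/\ x != 0, max_real_subfield iota E x,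
     ring_of_integers E x & ring_of_integers E x^-1]].

Definition Cp (L : fieldExtType rat) (E : {subfield L}) (p : nat)
  : set (set (set L)) :=
  [set c | class_set E c /\ class_exp E c p = class_one E].

Definition Cp_plus (L : fieldExtType rat) (iota : {rmorphism L -> algC})
  (E : {subfield L}) (p : nat) : set (set (set L)) :=
  [set c | Cp E p c /\ class_conj iota c = c].

Definition Cp_minus (L : fieldExtType rat) (iota : {rmorphism L -> algC})
  (E : {subfield L}) (p : nat) : set (set (set L)) :=
  [set c | Cp E p c /\ class_mul E c (class_conj iota c) = class_one E].

Definition cyclotomic_field (L : fieldExtType rat) (zeta : L) : {subfield L} :=
  <<1; zeta>>%AS.

Definition pi_ideal (L : fieldExtType rat) (zeta : L) : set L :=
  principal_ideal (cyclotomic_field zeta) (zeta - 1).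

Definition semi_primary (L : fieldExtType rat) (zeta A : L) : Prop :=
  let K := cyclotomic_field zeta in let pi := pi_ideal zeta in
  [/\ A \in K, val_eq0 K pi A & exists a : int, eqmod_ideal K pi 2 A a%:~R].

Definition not_pth_power (L : fieldExtType rat) (E : {subfield L}) (p : nat)
  (A : L) : Prop := ~ exists2 b, b \in E & b ^+ p = A.

Definition singular (L : fieldExtType rat) (E : {subfield L}) (p : nat)
  (A : L) : Prop :=
  [/\ ring_of_integers E A, not_pth_power E p A
    & exists2 I, is_ideal E I & principal_ideal E A = ideal_exp E I p].

(* The part common to the negative and the positive singular data: C is
   C_p^- or C_p^+, and e is 2m+1 or 2m. *)
Record class_data (L : splittingFieldType rat) (p : nat) (zeta : L) (v : nat)
  (sigma : gal_of (cyclotomic_field zeta)) (C : set (set (set L)))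
  (m e mu : nat) (A alpha : L) (Gamma : set (set (set L))) (I : set L)
  (a : nat) : Prop := ClassData {
    cd_subgroup : is_class_subgroup (cyclotomic_field zeta) Gamma;
    cd_sub : Gamma `<=` C;
    cd_order : Gamma #= `I_p;
    cd_annihilated : forall c, Gamma c ->
      class_image sigma c = class_exp (cyclotomic_field zeta) c mu;
    cd_singular : singular (cyclotomic_field zeta) p A;
    cd_semi_primary : semi_primary zeta A;
    cd_ideal : is_ideal (cyclotomic_field zeta) I;
    cd_factor : principal_ideal (cyclotomic_field zeta) A
                  = ideal_exp (cyclotomic_field zeta) I p;
    cd_nonprincipal : ~ exists x, I = principal_ideal (cyclotomic_field zeta) x;
    cd_mem : Gamma (ideal_class (cyclotomic_field zeta) I);
    cd_class :
      class_image sigma (ideal_class (cyclotomic_field zeta) I)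
        = class_exp (cyclotomic_field zeta)
            (ideal_class (cyclotomic_field zeta) I) mu;
    cd_alpha : alpha \in cyclotomic_field zeta;
    cd_sigma : sigma A = A ^+ mu * alpha ^+ p;
    cd_m : (1 <= m <= (p - 3)./2)%N;
    cd_mu : (mu = v ^ e %[mod p])%N;
    cd_a : (1 <= a <= p - 1)%N;
    cd_pi : ideal_exp (cyclotomic_field zeta) (pi_ideal zeta) e
              (A - a%:R ^+ p)
  }.

Definition negative_data (L : splittingFieldType rat)
  (iota : {rmorphism L -> algC}) (p : nat) (zeta : L) (v : nat)
  (sigma : gal_of (cyclotomic_field zeta)) (mu : nat) (A alpha : L) : Prop :=
  exists m Gamma I a,
    class_data p v sigma (Cp_minus iota (cyclotomic_field zeta) p)
      m (2 * m + 1)%N mu A alpha Gamma I a.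

Definition positive_data (L : splittingFieldType rat)
  (iota : {rmorphism L -> algC}) (p : nat) (zeta : L) (v : nat)
  (sigma : gal_of (cyclotomic_field zeta)) (mu : nat) (A alpha : L) : Prop :=
  exists m Gamma I a,
    class_data p v sigma (Cp_plus iota (cyclotomic_field zeta) p)
      m (2 * m)%N mu A alpha Gamma I a.

Record unit_data_for (L : splittingFieldType rat)
  (iota : {rmorphism L -> algC}) (p : nat) (zeta : L) (v : nat)
  (sigma : gal_of (cyclotomic_field zeta)) (m mu : nat) (A alpha : L)
  (a : nat) : Prop := UnitDataFor {
    ud_unit : real_units iota (cyclotomic_field zeta) A;
    ud_semi_primary : semi_primary zeta A;
    ud_not_power : not_pth_power (cyclotomic_field zeta) p A;
    ud_alpha : real_units iota (cyclotomic_field zeta) alpha;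
    ud_sigma : sigma A = A ^+ mu * alpha ^+ p;
    ud_m : (1 <= m <= (p - 3)./2)%N;
    ud_mu : (mu = v ^ (2 * m) %[mod p])%N;
    ud_a : (1 <= a <= p - 1)%N;
    ud_pi : ideal_exp (cyclotomic_field zeta) (pi_ideal zeta) (2 * m)%N
              (A - a%:R ^+ p)
  }.

Definition unit_data (L : splittingFieldType rat)
  (iota : {rmorphism L -> algC}) (p : nat) (zeta : L) (v : nat)
  (sigma : gal_of (cyclotomic_field zeta)) (mu : nat) (A alpha : L) : Prop :=
  exists m a, unit_data_for iota p v sigma m mu A alpha a.

Definition S_field (L : fieldExtType rat) (zeta omega : L) : {subfield L} :=
  <<cyclotomic_field zeta; omega>>%AS.

(* s is the extension sigma_(w) of sigma to S *)
Definition is_sigma_w (L : splittingFieldType rat) (p : nat) (zeta : L)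
  (sigma : gal_of (cyclotomic_field zeta)) (mu : nat) (alpha omega : L)
  (w : 'I_p) (s : gal_of (S_field zeta omega)) : Prop :=
  {in cyclotomic_field zeta, s =1 sigma} /\
  s omega = omega ^+ mu * alpha ^+ (p - 1) * zeta ^+ w.

Definition is_sigma_mu (L : splittingFieldType rat) (p : nat) (zeta : L)
  (sigma : gal_of (cyclotomic_field zeta)) (mu : nat) (alpha omega : L)
  (s : gal_of (S_field zeta omega)) : Prop :=
  exists2 w : 'I_p, is_sigma_w sigma mu alpha w s
    & eqmod_ideal (cyclotomic_field zeta) (pi_ideal zeta) 2
        (alpha ^+ (p - 1) * zeta ^+ w) 1.

(* Main.v *)
Require Import Defs.
From HB Require Import structures.
From mathcomp Require Import all_boot all_order all_algebra all_fingroup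
  all_solvable all_field.
From mathcomp Require Import boolp ring.
Set Implicit Arguments.
Unset Strict Implicit.
Unset Printing Implicit Defensive.
Import Order.TTheory GRing.Theory Num.Theory.
Local Open Scope ring_scope.

(* By Kummer theory [S : K] = p. Each sigma_mu^i(omega) is omega^(mu^i mod p)
   times an element of K congruent to 1 mod pi^2; for i = p - 1 that element is
   also a p-th root of unity, hence 1, so sigma_mu has order exactly p - 1 and
   its fixed field has degree p. Omega lies in that field, and it is not in K
   because its coefficient at omega in the basis 1, omega, .., omega^(p-1) is
   congruent mod pi to the number of i < p - 1 with mu^i = 1 mod p, which lies
   between 1 and p - 1. As p is prime, Q(Omega) is the whole fixed field.
   Congruences are taken in the localization of O_K at pi, so pi has to be prime.
   This follows from O_K = Z[lambda]: by Fourier inversion p O_K is contained in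
   Z[zeta], p is associate to lambda^(p-1), and Z[lambda] is saturated with
   respect to division by lambda in O_K. *)

(** * Rings of integers *)

Definition integers (L : fieldExtType rat) (E : {subfield L}) : {pred L} :=
  fun x => `[< ring_of_integers E x >].

Lemma integersP (L : fieldExtType rat) (E : {subfield L}) (x : L) :
  reflect (ring_of_integers E x) (x \in integers E).
Proof. exact: asboolP. Qed.

Fact integers_subring (L : fieldExtType rat) (E : {subfield L}) :
  subring_closed (integers E).
Proof.
split.
- by apply/integersP; split; [exact: mem1v | exact: integral1].
- move=> x y /integersP[Ex Zx] /integersP[Ey Zy]; apply/integersP; split.
    exact: rpredB.
  exact: integral_sub.
- move=> x y /integersP[Ex Zx] /integersP[Ey Zy]; apply/integersP; split.
    exact: rpredM.
  exact: integral_mul.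
Qed.

HB.instance Definition _ (L : fieldExtType rat) (E : {subfield L}) :=
  GRing.isSubringClosed.Build L (integers E) (integers_subring E).

Lemma mem_integers (L : fieldExtType rat) (E : {subfield L}) (x : L) :
  x \in integers E -> x \in E.
Proof. by case/integersP. Qed.

(** Integrality is transitive along the monic polynomial ['X^n - (x ^+ n)%:P]. In this way [zeta]
    and [omega] get their integrality from their [p]-th powers. *)
Lemma integers_root (L : fieldExtType rat) (E : {subfield L}) (x : L) (n : nat) :
  (0 < n)%N -> x \in E -> x ^+ n \in integers E -> x \in integers E.
Proof.
move=> n_gt0 Ex /integersP[_ Zxn]; apply/integersP; split=> //.
apply: (@integral_root_monic _ _ _ x ('X^n - (x ^+ n)%:P)).
- exact: monicXnsubC.
- by rewrite rootE !hornerE subrr.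
- apply/integral_poly => i; rewrite coefB coefXn coefC.
  apply: integral_sub; first by case: eqP => _; [exact: integral1 | exact: integral0].
  by case: eqP => _ //; exact: integral0.
Qed.

Lemma integers_gal (L : splittingFieldType rat) (E : {subfield L})
  (s : gal_of E) (x : L) : x \in integers E -> s x \in integers E.
Proof.
move=> /integersP[Ex [q q_mon qx0]]; apply/integersP; split; first exact: memv_gal.
exists q => //; have -> : map_poly intr q = map_poly s (map_poly intr q).
  by rewrite -map_poly_comp; apply: eq_map_poly => n /=; rewrite rmorph_int.
exact: rmorph_root.
Qed.

(* The embedding in [algC] is only there to reuse the fact that a rational
   algebraic integer is an integer. *)
Lemma integers_rat (L : fieldExtType rat) (iota : {rmorphism L -> algC})
  (E : {subfield L}) (x : L) :
  x \in integers E -> x \in 1%VS -> exists n : int, x = n%:~R.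
Proof.
move=> /integersP[_ [q q_mon qx0]] /vlineP[r Dx].
have iotaE : iota x = ratr r.
  rewrite Dx.
  exact: (fmorph_eq_rat (GRing.RMorphism.clone _ _ (iota \o in_alg L) _) r).
have : iota x \in Aint.
  apply: (@root_monic_Aint (map_poly intr q)); last first.
  - by apply/polyOverP => i; rewrite coef_map /= intr_int.
  - exact: monic_map.
  have -> : map_poly intr q = map_poly iota (map_poly intr q) :> {poly algC}.
    by rewrite -map_poly_comp; apply: eq_map_poly => n /=; rewrite rmorph_int.
  exact: rmorph_root.
move/Cint_rat_Aint; rewrite iotaE => /(_ (Crat_rat _)) /intrP[n Dn].
by exists n; apply: (fmorph_inj iota); rewrite iotaE Dn rmorph_int.
Qed.

Definition Zadjoin (L : fieldExtType rat) (z : L) : {pred L} :=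
  fun x => `[< exists q : {poly int}, x = (map_poly intr q).[z] >].

Lemma ZadjoinP (L : fieldExtType rat) (z x : L) :
  reflect (exists q : {poly int}, x = (map_poly intr q).[z]) (x \in Zadjoin z).
Proof. exact: asboolP. Qed.

Fact Zadjoin_subring (L : fieldExtType rat) (z : L) :
  subring_closed (Zadjoin z).
Proof.
split.
- by apply/ZadjoinP; exists 1; rewrite rmorph1 hornerE.
- move=> _ _ /ZadjoinP[q ->] /ZadjoinP[r ->]; apply/ZadjoinP; exists (q - r).
  by rewrite rmorphB !hornerE.
- move=> _ _ /ZadjoinP[q ->] /ZadjoinP[r ->]; apply/ZadjoinP; exists (q * r).
  by rewrite rmorphM !hornerE.
Qed.

HB.instance Definition _ (L : fieldExtType rat) (z : L) :=
  GRing.isSubringClosed.Build L (Zadjoin z) (Zadjoin_subring z).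

Lemma Zadjoin_gen (L : fieldExtType rat) (z : L) : z \in Zadjoin z.
Proof. by apply/ZadjoinP; exists 'X; rewrite map_polyX hornerX. Qed.

(** Splits off the constant coefficient. With [z = lam] every element of Z[lam] becomes congruent to
    an integer mod [lam], which drives both the descent and the primality of [lam]. *)
Lemma Zadjoin_split (L : fieldExtType rat) (z x : L) : x \in Zadjoin z ->
  exists (n : int) (y : L), y \in Zadjoin z /\ x = n%:~R + z * y.
Proof.
case/ZadjoinP=> q ->; elim/poly_ind: q => [|q c _].
  by exists 0, 0; rewrite rpred0 rmorph0 horner0 mulr0 addr0.
exists c, (map_poly intr q).[z]; split; first by apply/ZadjoinP; exists q.
by rewrite rmorphD rmorphM /= map_polyX map_polyC !hornerE /= addrC mulrC.
Qed.

Lemma Zadjoin_integers (L : fieldExtType rat) (E : {subfield L}) (z : L) :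
  z \in integers E -> {subset Zadjoin z <= integers E}.
Proof.
move=> Oz _ /ZadjoinP[q ->]; apply: rpred_horner => //.
by apply/polyOverP => i; rewrite coef_map /= rpred_int.
Qed.

(** * Roots of unity and the degree of a Kummer extension *)

Lemma sum_unity_root (L : fieldType) (p : nat) (r : L) :
  r ^+ p = 1 -> r != 1 -> \sum_(j < p) r ^+ j = 0.
Proof.
move=> rp1 r1; have /esym/eqP := subrX1 r p.
by rewrite rp1 subrr mulf_eq0 subr_eq0 (negPf r1) => /eqP.
Qed.

(** Both sides are the value at 1 of (X^p - 1)/(X - 1), written once as a product and once as a
    geometric sum. *)
Lemma prod_one_sub_unity_root (L : fieldType) (p : nat) (z : L) :
  p.-primitive_root z -> \prod_(1 <= i < p) (1 - z ^+ i) = p%:R.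
Proof.
move=> zP; have p_gt0 := prim_order_gt0 zP.
have : \prod_(1 <= i < p) ('X - (z ^+ i)%:P) = \sum_(i < p) 'X^i.
  have nz : 'X - 1%:P != 0 :> {poly L} by rewrite polyXsubC_eq0.
  apply: (mulfI nz); rewrite -[1%:P]/(1 : {poly L}) -subrX1 -(factor_Xn_sub_1 zP).
  by rewrite (@big_ltn _ _ _ 0) // expr0.
move/(congr1 (fun q => q.[1])); rewrite horner_prod horner_sum.
rewrite (eq_bigr (fun i => 1 - z ^+ i)) => [->|i _]; last by rewrite hornerXsubC.
rewrite (eq_bigr (fun=> 1)) => [|i _]; last by rewrite hornerXn expr1n.
by rewrite sumr_const card_ord.
Qed.

Lemma natr_Fp_eq1 (p n : nat) : prime p ->
  (n%:R == 1 :> 'F_p) = (n == 1 %[mod p]).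
Proof.
by move=> p_pr; rewrite -[1 in LHS]/(1%:R : 'F_p) -(inj_eq (@ord_inj _)) !val_Fp_nat.
Qed.

Lemma prod_Xsub_unity_root (F : fieldType) (p : nat) (z w : F) :
  p.-primitive_root z -> w != 0 ->
  \prod_(i < p) ('X - (z ^+ i * w)%:P) = 'X^p - (w ^+ p)%:P.
Proof.
move=> zP w0; have p_gt0 := prim_order_gt0 zP.
pose rs := [seq z ^+ i * w | i <- index_iota 0 p].
rewrite -(big_mkord xpredT (fun i => 'X - (z ^+ i * w)%:P)).
rewrite -(big_map (fun i => z ^+ i * w) xpredT (fun a => 'X - a%:P)) -/rs.
rewrite [RHS](@all_roots_prod_XsubC _ _ rs); first 1 last.
- by rewrite size_XnsubC // size_map size_iota subn0.
- apply/allP=> _ /mapP[i _ ->] /=; rewrite rootE !hornerE.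
  by rewrite exprMn exprAC (prim_expr_order zP) expr1n mul1r subrr.
- rewrite uniq_rootsE map_inj_in_uniq ?iota_uniq // => i j.
  rewrite !mem_index_iota => ltip ltjp /(mulIf w0)/eqP.
  by rewrite (eq_prim_root_expr zP) !modn_small // => /eqP.
by rewrite (monicP (monicXnsubC _ p_gt0)) scale1r.
Qed.

(** The minimal polynomial, of degree d, is a product of d of the factors X - z^i w, so its constant
    term is w^d times a nonzero element of [E], and w^d lies in [E]. If d < p, then d is prime to p
    and a Bezout relation writes w in terms of w^d and w^p, forcing w into [E]. *)
Lemma kummer_degree (F : fieldType) (L : fieldExtType F) (E : {subfield L})
    (p : nat) (z w : L) :
  prime p -> p.-primitive_root z -> z \in E -> w ^+ p \in E -> w \notin E ->
  adjoin_degree E w = p.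
Proof.
move=> p_pr zP Ez Ewp E'w; have p_gt0 := prime_gt0 p_pr.
have w0 : w != 0 by apply: contraNneq E'w => ->; apply: rpred0.
have : minPoly E w %| 'X^p - (w ^+ p)%:P.
  apply: minPoly_dvdp; first by rewrite rpredB ?rpredX ?polyOverX ?polyOverC.
  by rewrite rootE !hornerE subrr.
move=> min_dvd; have := dvdp_leq _ min_dvd.
rewrite -size_poly_gt0 size_XnsubC // size_minPoly ltnS => /(_ isT) le_dp.
move: min_dvd; rewrite -(prod_Xsub_unity_root zP w0) => /dvdp_prod_XsubC[m].
rewrite eqp_monic ?monic_minPoly ?monic_prod_XsubC // => /eqP Dmin.
set s := mask m _ in Dmin.
have Ds : size s = adjoin_degree E w.
  by have := size_minPoly E w; rewrite Dmin size_prod_XsubC => -[].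
have Ewd : w ^+ adjoin_degree E w \in E.
  have := congr1 (horner^~ 0) Dmin; rewrite horner_prod.
  rewrite (eq_bigr (fun i : 'I_p => - z ^+ i * w)) => [|i _]; last first.
    by rewrite hornerXsubC sub0r mulNr.
  rewrite big_split /= big_const_seq count_predT iter_mulr_1 Ds.
  set c := \prod_(i <- s) _ => Dc.
  have c0 : c != 0.
    rewrite /c prodf_seq_neq0; apply/allP => i _ /=.
    by rewrite oppr_eq0 expf_neq0 // (prim_root_eq0 zP) -lt0n.
  have -> : w ^+ adjoin_degree E w = c^-1 * (minPoly E w).[0] by rewrite Dc mulKf.
  apply: rpredM; last by rewrite rpred_horner ?minPolyOver ?rpred0.
  by rewrite rpredV rpred_prod // => i _; rewrite rpredN rpredX.
apply/eqP; move: le_dp; rewrite leq_eqVlt => /orP[//|lt_dp].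
have d_gt0 : (0 < adjoin_degree E w)%N by [].
case/negP: E'w; have co_dp : coprime (adjoin_degree E w) p.
  by rewrite coprime_sym prime_coprime // gtnNdvd.
have [[a b] /= Dab] := coprimeP p d_gt0 co_dp.
(* The Bezout relation uses truncated subtraction; since the difference is 1 it is a genuine one. *)
have Da : (a * adjoin_degree E w = 1 + b * p)%N.
  by rewrite -Dab subnK // ltnW // -subn_gt0 Dab.
have -> : w = (w ^+ adjoin_degree E w) ^+ a / (w ^+ p) ^+ b.
  by rewrite -!exprM mulnC Da [(p * b)%N]mulnC exprD mulfK ?expf_neq0.
by apply: rpred_div; apply: rpredX.
Qed.

(** * The prime above p in the cyclotomic field *)

Section Cyclotomic.

Variables (L : splittingFieldType rat) (iota : {rmorphism L -> algC}).
Variables (p : nat) (p_prime : prime p) (p_odd : odd p).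
Variables (zeta : L) (zeta_prim : p.-primitive_root zeta).
Variables (v : nat) (v_prim : (p - 1)%N.-primitive_root (v%:R : 'F_p)).
Variables (sigma : gal_of (cyclotomic_field zeta)).
Hypothesis (sigma_zeta : sigma zeta = zeta ^+ v).

Local Notation K := (cyclotomic_field zeta).
Local Notation OK := (integers K).
Local Notation lam := (zeta - 1).

Let p_gt1 : (1 < p)%N := prime_gt1 p_prime.
Let p_gt0 : (0 < p)%N := prime_gt0 p_prime.
Let p_gt2 : (2 < p)%N := odd_prime_gt2 p_odd p_prime.

Lemma zeta_mem : zeta \in K.
Proof. exact: memv_adjoin. Qed.

Lemma zeta_neq0 : zeta != 0.
Proof. by rewrite (prim_root_eq0 zeta_prim) -lt0n. Qed.

Lemma zeta_integer : zeta \in OK.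
Proof.
apply: (integers_root p_gt0 zeta_mem).
by rewrite (prim_expr_order zeta_prim) rpred1.
Qed.

Lemma lam_integer : lam \in OK.
Proof. by rewrite rpredB ?zeta_integer ?rpred1. Qed.

Lemma lam_neq0 : lam != 0.
Proof.
rewrite subr_eq0 -{1}[zeta]expr1 -(expr0 zeta) (eq_prim_root_expr zeta_prim).
by rewrite !modn_small.
Qed.

Lemma Zlam_integers : {subset Zadjoin lam <= OK}.
Proof. exact: Zadjoin_integers lam_integer. Qed.

Lemma Zlam_zeta : zeta \in Zadjoin lam.
Proof. by rewrite -[X in X \in _](subrK 1) rpredD ?Zadjoin_gen ?rpred1. Qed.

Lemma gal_zeta_expr i : (sigma ^+ i)%g zeta = zeta ^+ (v ^ i).
Proof.
elim: i => [|i IH]; first by rewrite expg0 gal_id.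
by rewrite expgSr galM ?zeta_mem // IH rmorphXn /= sigma_zeta -exprM expnS.
Qed.

(** As [v] is a primitive root, v^i = 1 mod p exactly when p - 1 divides i. *)
Lemma gal_zeta_fix i : ((sigma ^+ i)%g zeta == zeta) = (p - 1 %| i)%N.
Proof.
rewrite gal_zeta_expr -{2}[zeta]expr1 (eq_prim_root_expr zeta_prim).
by rewrite (prim_order_dvd v_prim) -natrX natr_Fp_eq1.
Qed.

Lemma gal_expr_eq1 i : ((sigma ^+ i)%g == 1%g) = (p - 1 %| i)%N.
Proof.
rewrite -gal_zeta_fix; apply/idP/idP => [/eqP->|/eqP si]; first by rewrite gal_id.
have in_gal (s : gal_of K) : s \in 'Gal(K / 1)%g.
  by rewrite gal_kHom ?sub1v // k1AHom.
by rewrite (gal_adjoin_eq (in_gal _) (in_gal _)) si gal_id.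
Qed.

Lemma gal_order : #[sigma]%g = (p - 1)%N.
Proof.
apply/eqP; rewrite eqn_dvd order_dvdn gal_expr_eq1 dvdnn /=.
by rewrite -gal_expr_eq1 expg_order.
Qed.

Lemma dim_cyclotomic_le : (\dim K <= p - 1)%N.
Proof.
have -> : \dim K = adjoin_degree 1%AS zeta.
  rewrite (dim_Fadjoin 1%AS zeta) dimv1; by rewrite muln1.
have sumX : \sum_(i < p) 'X^i = \poly_(i < p) (1 : L).
  by rewrite poly_def; apply: eq_bigr => i _; rewrite scale1r.
have nz : \sum_(i < p) 'X^i != 0 :> {poly L}.
  rewrite sumX -size_poly_eq0 size_poly_eq ?oner_eq0 //.
  by rewrite -lt0n.
suff : minPoly 1%AS zeta %| \sum_(i < p) 'X^i.
  move/(dvdp_leq nz); rewrite size_minPoly sumX size_poly_eq ?oner_eq0 //.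
  by move=> lt_deg; rewrite subn1 -ltnS prednK.
apply: minPoly_dvdp.
  rewrite sumX; apply/polyOverP => i; rewrite coef_poly.
  by case: ifP; rewrite ?rpred0 ?rpred1.
rewrite rootE horner_sum (eq_bigr (fun i : 'I_p => zeta ^+ i)) => [|i _].
  by rewrite sum_unity_root ?(prim_expr_order zeta_prim) // -subr_eq0 lam_neq0.
by rewrite hornerXn.
Qed.

(** The lower bound is Artin's theorem: [K] has degree [p - 1] over the fixed field of the group
    generated by [sigma]. *)
Lemma dim_cyclotomic : \dim K = (p - 1)%N.
Proof.
apply/eqP; rewrite eqn_leq dim_cyclotomic_le /=.
have := dim_fixedField <[sigma]>%G; rewrite -[#|_|]/#[sigma]%g gal_order => ->.
exact: leq_div.
Qed.

Lemma fixed_rat x : x \in K -> sigma x = x -> x \in 1%VS.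
Proof.
move=> Kx sx; have : x \in fixedField <[sigma]>%g.
  apply/fixedFieldP => // _ /cycleP[i ->].
  elim: i => [|i IH]; first by rewrite expg0 gal_id.
  by rewrite expgSr galM // IH.
suff -> : fixedField <[sigma]>%g = 1%VS by [].
have := dim_fixedField <[sigma]>%G; rewrite -[#|_|]/#[sigma]%g gal_order.
move=> dimE; have := dim_sup_field (fixedField_bound <[sigma]>%g).
rewrite -dimE dim_cyclotomic => /eqP; rewrite -{1}[(p - 1)%N]muln1.
rewrite eqn_pmul2l ?subn_gt0 // => /eqP dim1.
apply/esym/eqP; rewrite eqEdim dimv1 -dim1 leqnn andbT.
exact: sub1v.
Qed.

(** * The equality of O_K with Z[lam] and the primality of [lam] *)

Definition Zassociate (a b : L) : Prop := exists y z : L,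
  [/\ y \in Zadjoin lam, z \in Zadjoin lam, a = b * y & b = a * z].

Lemma Zassociate_prod a b c d :
  Zassociate a b -> Zassociate c d -> Zassociate (a * c) (b * d).
Proof.
move=> [y [z [Zy Zz Da Db]]] [y' [z' [Zy' Zz' Dc Dd]]].
exists (y * y'), (z * z'); split; try exact: rpredM.
  by rewrite Da Dc mulrACA.
by rewrite {1}Db {1}Dd mulrACA.
Qed.

(** Geometric sums give both quotients. For the second, take u inverse to i mod p, so that zeta =
    (zeta^i)^u. *)
Lemma one_sub_zeta_associate i : (0 < i < p)%N -> Zassociate (1 - zeta ^+ i) lam.
Proof.
case/andP=> i_gt0 lt_ip; have co_ip : coprime i p.
  by rewrite coprime_sym prime_coprime // gtnNdvd.
have [[u w] /= Duw] := coprimeP p i_gt0 co_ip.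
exists (- \sum_(j < i) zeta ^+ j), (- \sum_(j < u) (zeta ^+ i) ^+ j); split.
- by rewrite rpredN rpred_sum // => j _; rewrite rpredX // Zlam_zeta.
- by rewrite rpredN rpred_sum // => j _; rewrite !rpredX // Zlam_zeta.
- by rewrite mulrN -subrX1 opprB.
- rewrite -[1 - zeta ^+ i]opprB mulrNN -subrX1 -exprM.
  have -> : (i * u = 1 + w * p)%N.
    have := leq_subr (w * p) (u * i); rewrite Duw; rewrite mulnC in Duw *.
    by rewrite -Duw => _; rewrite subnK // ltnW // -subn_gt0 Duw.
  by rewrite exprD mulnC exprM (prim_expr_order zeta_prim) expr1n mulr1.
Qed.

Lemma p_associate : Zassociate p%:R (lam ^+ (p - 1)).
Proof.
rewrite -(prod_one_sub_unity_root zeta_prim) -prodr_const_nat.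
rewrite big_nat [X in Zassociate _ X]big_nat.
elim/big_rec2: _ => [|i a b lt_ip]; last first.
  by apply: Zassociate_prod; apply: one_sub_zeta_associate.
by exists 1, 1; rewrite mulr1 rpred1.
Qed.

(** Here p > 2 enters: p - 1 is at least 2, so congruences mod p imply congruences mod pi^2. *)
Lemma p_lam_sqr : exists2 y, y \in Zadjoin lam & p%:R = lam ^+ 2 * y.
Proof.
have [y [_ [Zy _ -> _]]] := p_associate; exists (lam ^+ (p - 3) * y).
  by rewrite rpredM ?rpredX ?Zadjoin_gen.
by rewrite mulrA -exprD; congr (_ ^+ _ * _); rewrite -(subnK p_gt2) !addnK addnC.
Qed.

(** Otherwise p and n are coprime and both divisible by [lam], so [lam] is a unit of O_K. Then so is
    p, an associate of a power of [lam], and 1/p would be a rational algebraic integer. *)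
Lemma lam_dvd_int (n : int) (c : L) :
  c \in OK -> n%:~R = lam * c -> (p %| n)%Z.
Proof.
move=> Oc Dn; apply/negPn/negP => p'n.
have /coprimezP[[a b] /= Dab] : coprimez p n.
  by rewrite coprimezE absz_nat prime_coprime // -(absz_nat p) -dvdzE.
have [y Zy Dp] := p_lam_sqr; have [y' [z [_ Zz _ Dlam]]] := p_associate.
(* The Bezout relation divided by [lam]: [t] is the inverse of [lam]. *)
pose t := a%:~R * lam * y + b%:~R * c.
have Ot : t \in OK.
  by rewrite rpredD ?rpredM ?rpred_int ?lam_integer ?(Zlam_integers Zy).
have D1 : lam * t = 1.
  have /(congr1 (fun m : int => m%:~R : L)) := Dab.
  rewrite rmorphD !rmorphM /= Dn -pmulrn Dp rmorph1 => E1; rewrite -[RHS]E1.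
  rewrite /t expr2; ring.
have Dpz : p%:R * (z * t ^+ (p - 1)) = 1.
  by rewrite mulrA -Dlam -exprMn D1 expr1n.
have Oz : z * t ^+ (p - 1) \in OK by rewrite rpredM ?rpredX ?(Zlam_integers Zz).
have p_neq0 : p%:R != 0 :> L.
  by apply/eqP => p0; move: Dpz; rewrite p0 mul0r => /esym/eqP; rewrite oner_eq0.
have Qz : z * t ^+ (p - 1) \in 1%VS.
  have -> : z * t ^+ (p - 1) = p%:R^-1 by apply: (mulfI p_neq0); rewrite Dpz divff.
  by rewrite (rpredV 1%AS) (rpred_nat 1%AS).
have [m Dm] := integers_rat iota Oz Qz.
have pm1 : p%:Z * m = 1.
  apply: (@intr_inj algC); rewrite -!(rmorph_int iota) rmorphM /= -pmulrn -Dm.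
  by rewrite Dpz.
have : (p %| 1)%Z by apply/dvdzP; exists m; rewrite mulrC.
by rewrite dvdzE /= dvdn1 => /eqP p1; move: p_gt1; rewrite p1.
Qed.

(** One factor [lam] is removed at a time. If lam^(n+1) c = m + lam y with m an integer, then [lam]
    divides m in O_K, so p divides m; since p is a multiple of lam^2 in Z[lam], the division by
    [lam] stays in Z[lam]. *)
Lemma Zlam_descent n (c : L) :
  c \in OK -> lam ^+ n * c \in Zadjoin lam -> c \in Zadjoin lam.
Proof.
move=> Oc; elim: n => [|n IH]; first by rewrite expr0 mul1r.
move=> Zc; apply: IH; have [m [y [Zy Dc]]] := Zadjoin_split Zc.
have Dm : m%:~R = lam * (lam ^+ n * c - y).
  by rewrite mulrBr mulrA -exprS Dc addrK.
have Om : lam ^+ n * c - y \in OK.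
  by rewrite rpredB ?rpredM ?rpredX ?lam_integer ?(Zlam_integers Zy).
have /dvdzP[k Dk] := lam_dvd_int Om Dm; have [z Zz Dp] := p_lam_sqr.
have -> : lam ^+ n * c = k%:~R * lam * z + y.
  apply: (mulfI lam_neq0); rewrite mulrDr mulrA -exprS Dc; congr (_ + _).
  rewrite Dk rmorphM /= -pmulrn Dp expr2; ring.
by rewrite rpredD ?rpredM ?rpred_int ?Zadjoin_gen.
Qed.

(* Fourier inversion on the group of [p]-th roots of unity: the inner sum over
   [j] vanishes unless the conjugate is the trivial one. *)
Lemma trace_expansion x : x \in K ->
  p%:R * x = \sum_(j < p)
    (\sum_(i < p - 1) (sigma ^+ i)%g (x * zeta ^- j)) * zeta ^+ j.
Proof.
move=> Kx; under eq_bigr do rewrite mulr_suml.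
rewrite exchange_big /=.
have lt0 : (0 < p - 1)%N by rewrite subn_gt0.
rewrite (bigD1 (Ordinal lt0)) //= [X in _ = _ + X]big1 ?addr0 => [|i i_neq0].
  rewrite (eq_bigr (fun=> x)) ?sumr_const ?card_ord ?mulr_natl // => j _.
  by rewrite expg0 gal_id mulfVK // expf_neq0 // zeta_neq0.
pose r := zeta / (sigma ^+ i)%g zeta.
rewrite (eq_bigr (fun j : 'I_p => (sigma ^+ i)%g x * r ^+ j)) => [|j _]; last first.
  by rewrite rmorphM fmorphV rmorphXn /= expr_div_n -mulrA [_^-1 * _]mulrC.
have s_neq0 : (sigma ^+ i)%g zeta != 0 by rewrite fmorph_eq0 zeta_neq0.
rewrite -mulr_sumr sum_unity_root ?mulr0 //.
  by rewrite expr_div_n -rmorphXn /= (prim_expr_order zeta_prim) rmorph1 divr1.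
rewrite /r -subr_eq0 -(divff s_neq0) -mulrBl mulf_neq0 ?invr_neq0 //.
rewrite subr_eq0 eq_sym gal_zeta_fix gtnNdvd // lt0n.
by apply: contraNneq i_neq0 => i0; apply/eqP/val_inj.
Qed.

(** The sum is the trace from [K] to the rationals: [sigma] permutes its terms cyclically, so it is
    rational, and being integral it is an integer. *)
Lemma trace_int x : x \in OK ->
  exists n : int, \sum_(i < p - 1) (sigma ^+ i)%g x = n%:~R.
Proof.
move=> Ox; have Kx := mem_integers Ox.
apply: (integers_rat iota (E := K)).
  by rewrite rpred_sum // => i _; rewrite integers_gal.
apply: fixed_rat; first by rewrite rpred_sum // => i _; rewrite memv_gal.
rewrite rmorph_sum /= -(prednK (n := p - 1)) ?subn_gt0 //.
rewrite big_ord_recr [RHS]big_ord_recl /= addrC; congr (_ + _).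
  rewrite -galM // -expgSr prednK ?subn_gt0 //.
  by have /eqP -> : (sigma ^+ (p - 1))%g == 1%g by rewrite gal_expr_eq1.
by apply: eq_bigr => i _; rewrite -galM // -expgSr.
Qed.

Lemma integers_Zlam : {subset OK <= Zadjoin lam}.
Proof.
move=> x Ox; have Kx := mem_integers Ox.
have [y [z [Zy Zz Dp Dlam]]] := p_associate.
have Zpx : p%:R * x \in Zadjoin lam.
  rewrite trace_expansion // rpred_sum // => j _.
  have [|n ->] := @trace_int (x * zeta ^- j).
    (* A nonnegative exponent makes the integrality of the inverse power visible. *)
    rewrite rpredM //; have -> : zeta ^- j = zeta ^+ (p - j).
      apply: (mulfI (expf_neq0 j zeta_neq0)); rewrite divff ?expf_neq0 ?zeta_neq0 //.
      by rewrite -exprD subnKC ?(ltnW (ltn_ord j)) // (prim_expr_order zeta_prim).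
    by rewrite rpredX ?zeta_integer.
  by rewrite rpredM ?rpred_int // rpredX ?Zlam_zeta.
(* The descent removes lam^(p-1) from p x = lam^(p-1) y x; the remaining factor [y] is a unit of
   Z[lam] with inverse [z]. *)
have Zyx : y * x \in Zadjoin lam.
  apply: (@Zlam_descent (p - 1)); first by rewrite rpredM ?(Zlam_integers Zy).
  by rewrite mulrA -Dp.
have yz : z * y = 1.
  have lam_n0 : lam ^+ (p - 1) != 0 by rewrite expf_neq0 ?lam_neq0.
  by apply: (mulfI lam_n0); rewrite mulr1 [z * y]mulrC mulrA -Dp -Dlam.
have -> : x = z * (y * x) by rewrite mulrA yz mul1r.
by rewrite rpredM.
Qed.

Lemma integers_mod_lam x : x \in OK ->
  exists (n : int) (y : L), y \in OK /\ x = n%:~R + lam * y.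
Proof.
move=> /integers_Zlam/Zadjoin_split[n [y [Zy ->]]].
by exists n, y; rewrite Zlam_integers.
Qed.

Definition lam_dvd (x : L) : Prop := exists2 y, y \in OK & x = lam * y.

(** Modulo [lam] both factors are integers m and n. Then p divides m n, Euclid's lemma applies to p,
    and [lam] divides p. *)
Lemma lam_prime x y : x \in OK -> y \in OK ->
  lam_dvd (x * y) -> lam_dvd x \/ lam_dvd y.
Proof.
move=> Ox Oy [z Oz Dxy].
have [m [x' [Ox' Dx]]] := integers_mod_lam Ox.
have [n [y' [Oy' Dy]]] := integers_mod_lam Oy.
have : (p %| m * n)%Z.
  apply: (@lam_dvd_int _ (z - m%:~R * y' - n%:~R * x' - lam * x' * y')).
    by rewrite !rpredB ?rpredM ?rpred_int ?lam_integer.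
  rewrite rmorphM /= !mulrBr -Dxy Dx Dy; ring.
rewrite dvdzE abszM Euclid_dvdM //= -!(dvdzE p) => pmn.
have [w Zw Dp] := p_lam_sqr; have Ow := Zlam_integers Zw.
have lam_p k : (p %| k)%Z -> lam_dvd k%:~R.
  case/dvdzP=> q ->; exists (q%:~R * lam * w).
    by rewrite !rpredM ?rpred_int ?lam_integer.
  rewrite rmorphM /= -pmulrn Dp expr2; ring.
have lam_add k t : t \in OK -> lam_dvd k%:~R -> lam_dvd (k%:~R + lam * t).
  by move=> Ot [u Ou ->]; exists (u + t); rewrite ?rpredD // mulrDr.
case/orP: pmn => /lam_p lam_k.
  by left; rewrite Dx; apply: lam_add.
by right; rewrite Dy; apply: lam_add.
Qed.

(** * Congruences in the local ring at pi *)

Lemma lam_dvdM x y : y \in OK -> lam_dvd x -> lam_dvd (x * y).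
Proof. by move=> Oy [z Oz ->]; exists (z * y); rewrite ?rpredM // mulrA. Qed.

Lemma lam_dvdB x y : lam_dvd x -> lam_dvd y -> lam_dvd (x - y).
Proof. by move=> [z Oz ->] [t Ot ->]; exists (z - t); rewrite ?rpredB // mulrBr. Qed.

Lemma lam_dvd_nat n : lam_dvd n%:R -> (p %| n)%N.
Proof. by move=> [y Oy Dn]; apply: (@lam_dvd_int n y). Qed.

Lemma pi_idealE x : pi_ideal zeta x <-> lam_dvd x.
Proof.
split=> [[y /integersP Oy <-]|[y /integersP Oy ->]]; first by exists y.
by exists y.
Qed.

Lemma ideal_exp_piE n x :
  ideal_exp K (pi_ideal zeta) n x <-> exists2 y, y \in OK & x = lam ^+ n * y.
Proof.
elim: n x => [|n IH] x.
  split=> [/integersP Ox|[y Oy ->]]; first by exists x; rewrite ?expr0 ?mul1r.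
  by rewrite expr0 mul1r; apply/integersP.
rewrite /ideal_exp iterS; split=> [[k [a [b [pi_a pi_b ->]]]]|[y Oy ->]].
  elim/big_ind: _ => [|_ _ [y Oy ->] [z Oz ->]|i _].
  - by exists 0; rewrite ?rpred0 ?mulr0.
  - by exists (y + z); rewrite ?rpredD ?mulrDr.
  have [y Oy ->] := (pi_idealE _).1 (pi_a i).
  have [z Oz ->] := (IH _).1 (pi_b i).
  by exists (y * z); rewrite ?rpredM // mulrACA -exprS.
exists 1%N, (fun=> lam), (fun=> lam ^+ n * y); split=> [_|_|].
- by apply/pi_idealE; exists 1; rewrite ?rpred1 ?mulr1.
- by apply/IH; exists y.
- by rewrite big_ord1 mulrA exprS.
Qed.

(** Elementwise form of [val_ge] at pi, available because pi is generated by [lam]; [b] is a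
    denominator prime to pi. *)
Definition local_dvd (n : nat) (x : L) : Prop := exists b c : L,
  [/\ b \in OK, c \in OK, ~ lam_dvd b & b * x = lam ^+ n * c].

Lemma val_geE n x : val_ge K (pi_ideal zeta) n x <-> local_dvd n x.
Proof.
split=> [[b [/integersP Ob pi'b] /ideal_exp_piE[c Oc Dc]]|[b [c [Ob Oc pi'b Dc]]]].
  by exists b, c; split=> // /pi_idealE.
exists b; first by split; [exact/integersP | move/pi_idealE].
by apply/ideal_exp_piE; exists c.
Qed.

(** Primality of [lam] enters the localization here: it lets two denominators be multiplied, as sums
    and products require. *)
Lemma local_denM b b' : b \in OK -> b' \in OK ->
  ~ lam_dvd b -> ~ lam_dvd b' -> ~ lam_dvd (b * b').
Proof. by move=> Ob Ob' pi'b pi'b' /(lam_prime Ob Ob')[]. Qed.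

Lemma local_dvdD n x y : local_dvd n x -> local_dvd n y -> local_dvd n (x + y).
Proof.
move=> [b [c [Ob Oc pi'b Dc]]] [b' [c' [Ob' Oc' pi'b' Dc']]].
exists (b * b'), (b' * c + b * c'); split; last first.
- have -> : b * b' * (x + y) = b' * (b * x) + b * (b' * y) by ring.
  rewrite Dc Dc'; ring.
- exact: local_denM.
- by rewrite rpredD ?rpredM.
- exact: rpredM.
Qed.

Lemma local_dvdM m n x y :
  local_dvd m x -> local_dvd n y -> local_dvd (m + n) (x * y).
Proof.
move=> [b [c [Ob Oc pi'b Dc]]] [b' [c' [Ob' Oc' pi'b' Dc']]].
exists (b * b'), (c * c'); split; last first.
- by rewrite mulrACA Dc Dc' exprD mulrACA.
- exact: local_denM.
- exact: rpredM.
- exact: rpredM.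
Qed.

Lemma local_dvd_leq m n x : (m <= n)%N -> local_dvd n x -> local_dvd m x.
Proof.
move=> le_mn [b [c [Ob Oc pi'b Dc]]]; exists b, (lam ^+ (n - m) * c); split=> //.
  by rewrite rpredM ?rpredX ?lam_integer.
by rewrite mulrA -exprD subnKC.
Qed.

Lemma lam_dvd1 : ~ lam_dvd 1.
Proof. by move/(@lam_dvd_nat 1); rewrite dvdn1 => /eqP p1; move: p_gt1; rewrite p1. Qed.

Lemma local_dvd_integer n x : x \in OK -> local_dvd n (lam ^+ n * x).
Proof.
move=> Ox; exists 1, x; split; rewrite ?rpred1 ?mul1r //.
exact: lam_dvd1.
Qed.

Lemma local_dvd0 x : x \in OK -> local_dvd 0 x.
Proof. by move=> Ox; rewrite -[x]mul1r; apply: (@local_dvd_integer 0). Qed.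

(** p is divisible by lam^2, while conversely a single factor [lam] in an integer already forces a
    factor p. *)
Lemma local_dvd_natP n : (p %| n)%N <-> local_dvd 2 (n%:R).
Proof.
split=> [/dvdnP[q ->]|[b [c [Ob Oc pi'b Dc]]]].
  have [y Zy Dp] := p_lam_sqr; rewrite natrM mulrC Dp -mulrA.
  by apply: local_dvd_integer; rewrite rpredM ?rpred_nat // (Zlam_integers Zy).
apply: lam_dvd_nat; have On : n%:R \in OK by rewrite rpred_nat.
have : lam_dvd (b * n%:R).
  by rewrite Dc expr2 -mulrA; exists (lam * c); rewrite ?rpredM ?lam_integer.
by case/(lam_prime Ob On).
Qed.

Lemma zeta_expr_sub1 i : zeta ^+ i - 1 = lam * \sum_(j < i) zeta ^+ j.
Proof. exact: subrX1. Qed.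

Lemma sum_zeta_integer i : \sum_(j < i) zeta ^+ j \in OK.
Proof. by rewrite rpred_sum // => j _; rewrite rpredX ?zeta_integer. Qed.

Lemma lam_dvd_gal i b : b \in OK -> lam_dvd b -> lam_dvd ((sigma ^+ i)%g b).
Proof.
move=> Ob [c Oc ->]; rewrite rmorphM rmorphB rmorph1 /= gal_zeta_expr.
apply: lam_dvdM; first exact: integers_gal.
by rewrite zeta_expr_sub1; exists (\sum_(j < v ^ i) zeta ^+ j); rewrite ?sum_zeta_integer.
Qed.

Lemma local_dvd_gal n x : x \in K -> local_dvd n x -> local_dvd n (sigma x).
Proof.
move=> Kx [b [c [Ob Oc pi'b Dc]]].
exists (sigma b), ((\sum_(j < v) zeta ^+ j) ^+ n * sigma c); split.
- exact: integers_gal.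
- by rewrite rpredM ?rpredX ?sum_zeta_integer ?integers_gal.
(* The inverse of [sigma] is its power [p - 2], so divisibility of [sigma b] by [lam] would pass
   back to [b]. *)
- move=> /(lam_dvd_gal (p - 1).-1 (integers_gal _ Ob)).
  rewrite -galM ?(mem_integers Ob) // -expgS prednK ?subn_gt0 //.
  by have /eqP -> : (sigma ^+ (p - 1))%g == 1%g; rewrite ?gal_expr_eq1 // gal_id.
- rewrite -rmorphM /= Dc rmorphM rmorphXn rmorphB rmorph1 /= sigma_zeta.
  by rewrite zeta_expr_sub1 exprMn mulrA.
Qed.

(** Congruence to 1 mod pi^2, stable under products and [sigma]. The modulus is pi^2 because every
    power of [zeta] is 1 mod pi, whereas mod pi^2 only the trivial one is. *)
Definition cong1 (x : L) : Prop := x \in K /\ local_dvd 2 (x - 1).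

Lemma cong1_1 : cong1 1.
Proof.
split; first exact: rpred1.
by rewrite subrr -(mulr0 (lam ^+ 2)); apply/local_dvd_integer/rpred0.
Qed.

Lemma cong1M x y : cong1 x -> cong1 y -> cong1 (x * y).
Proof.
move=> [Kx cx] [Ky cy]; split; first exact: rpredM.
have -> : x * y - 1 = (x - 1) * (y - 1) + (x - 1) + (y - 1) by ring.
by do !apply: local_dvdD => //; apply: (@local_dvd_leq _ 4) => //; apply: (@local_dvdM 2 2).
Qed.

Lemma cong1X n x : cong1 x -> cong1 (x ^+ n).
Proof.
move=> cx; elim: n => [|n IH]; first exact: cong1_1.
by rewrite exprS; apply: cong1M.
Qed.

Lemma cong1_gal x : cong1 x -> cong1 (sigma x).
Proof.
move=> [Kx cx]; split; first exact: memv_gal.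
by rewrite -(rmorph1 sigma) -rmorphB; apply: local_dvd_gal; rewrite ?rpredB ?rpred1.
Qed.

(** Dividing zeta^j - 1 by [lam] leaves the sum of zeta^i for i < j, which is congruent to j mod
    [lam]. *)
Lemma cong1_zeta j : cong1 (zeta ^+ j) -> (p %| j)%N.
Proof.
case=> _ [b [c [Ob Oc pi'b]]]; rewrite zeta_expr_sub1 expr2 -mulrA mulrCA.
move/(mulfI lam_neq0) => Dc; apply: lam_dvd_nat.
have lam_prod : lam_dvd (b * \sum_(i < j) zeta ^+ i) by rewrite Dc; exists c.
have [//|lam_sum] := lam_prime Ob (sum_zeta_integer j) lam_prod.
have -> : j%:R = \sum_(i < j) zeta ^+ i - \sum_(i < j) (zeta ^+ i - 1).
  by rewrite sumrB sumr_const card_ord subKr.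
apply: lam_dvdB => //; elim/big_ind: _ => [|x y lx ly|i _].
- by exists 0; rewrite ?rpred0 ?mulr0.
- rewrite -[y]opprK; apply: lam_dvdB => //; rewrite -sub0r; apply: lam_dvdB => //.
  by exists 0; rewrite ?rpred0 ?mulr0.
- by rewrite zeta_expr_sub1; exists (\sum_(k < i) zeta ^+ k); rewrite ?sum_zeta_integer.
Qed.

(** Modulo pi^2 the sum is the number of its terms, which p does not divide. *)
Lemma cong1_sum_neq0 (I : finType) (P : pred I) (F : I -> L) :
  (forall i, P i -> cong1 (F i)) -> (0 < #|P| < p)%N -> \sum_(i | P i) F i != 0.
Proof.
move=> cF /andP[P_gt0 ltPp]; apply/eqP => sum0.
have : local_dvd 2 (#|P|%:R); last first.
  by move/local_dvd_natP; rewrite gtnNdvd.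
have -> : #|P|%:R = -1 * \sum_(i | P i) (F i - 1).
  by rewrite sumrB sum0 sumr_const sub0r mulN1r opprK.
apply: (@local_dvdM 0 2); first by apply: local_dvd0; rewrite rpredN rpred1.
elim/big_ind: _ => [|x y|i /cF[]//]; last exact: local_dvdD.
by have [_] := cong1_1; rewrite subrr.
Qed.

(** Modulo pi^2, [A] is an integer prime to p because its valuation is 0; Fermat's little theorem
    gives the rest. *)
Lemma semi_primary_cong1 A : semi_primary zeta A -> cong1 (A ^+ (p - 1)).
Proof.
case=> KA [_ val1] [a /val_geE cA]; split; first exact: rpredX.
(* Reducing a mod p makes it a natural number, as Euler's theorem expects; this is harmless mod
   pi^2, which divides p. *)
pose n := `|(a %% p)%Z|%N.
have nE : n%:Z = (a %% p)%Z by rewrite gez0_abs // modz_ge0 // -lt0n.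
have {cA}cA : local_dvd 2 (A - n%:R).
  have -> : A - n%:R = (A - a%:~R) + (a %/ p)%Z%:~R * p%:R.
    rewrite {1}(divz_eq a p) -nE rmorphD rmorphM /= -!pmulrn; ring.
  apply: local_dvdD => //; apply: (@local_dvdM 0 2).
    by apply: local_dvd0; rewrite rpred_int.
  by apply/local_dvd_natP.
have p'n : ~~ (p %| n)%N.
  apply/negP => /local_dvd_natP pn; apply: val1; apply/val_geE.
  by apply: (@local_dvd_leq _ 2) => //; rewrite -[A](subrK n%:R); apply: local_dvdD.
have locA : local_dvd 0 A.
  rewrite -[A](subrK n%:R); apply: local_dvdD; first exact: local_dvd_leq cA.
  by apply: local_dvd0; rewrite rpred_nat.
have cAk k : local_dvd 2 (A ^+ k - n%:R ^+ k).
  elim: k => [|k IH]; first by have [_] := cong1_1; rewrite !expr0.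
  have -> : A ^+ k.+1 - n%:R ^+ k.+1 = A * (A ^+ k - n%:R ^+ k) + n%:R ^+ k * (A - n%:R).
    rewrite !exprS; ring.
  apply: local_dvdD; apply: (@local_dvdM 0 2) => //.
  by apply: local_dvd0; rewrite rpredX ?rpred_nat.
rewrite -[A ^+ _](subrK (n%:R ^+ (p - 1))) -addrA; apply: local_dvdD => //.
have /eqP : (n ^ (p - 1) = 1 %[mod p])%N.
  by rewrite subn1 -(totient_prime p_prime) Euler_exp_totient // coprime_sym prime_coprime.
have n_gt0 : (0 < n ^ (p - 1))%N.
  by rewrite expn_gt0 lt0n; case: eqP p'n => // ->; rewrite dvdn0.
by rewrite eqn_mod_dvd // -natrX -(natrB _ n_gt0) => /local_dvd_natP.
Qed.

(** * The Kummer extension *)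

Section KummerExtension.

Variables (mu : nat) (A alpha omega : L).
Hypothesis mu_range : (1 <= mu <= p - 1)%N.
Hypothesis A_integer : A \in OK.
Hypothesis A_nonpower : not_pth_power K p A.
Hypothesis A_semi_primary : semi_primary zeta A.
Hypothesis alpha_mem : alpha \in K.
Hypothesis omega_root : omega ^+ p = A ^+ (p - 1).

Local Notation S := (S_field zeta omega).

Variable tau : gal_of S.
Hypothesis tauP : is_sigma_mu p sigma mu alpha tau.

Lemma A_neq0 : A != 0.
Proof.
apply/eqP => A0; apply: A_nonpower; exists 0; first exact: rpred0.
by rewrite A0 expr0n eqn0Ngt p_gt0.
Qed.

Lemma omega_neq0 : omega != 0.
Proof.
apply: contraNneq A_neq0 => om0; move: omega_root.
by rewrite om0 expr0n eqn0Ngt p_gt0 => /esym/eqP; rewrite expf_eq0 => /andP[].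
Qed.

Lemma omega_mem : omega \in S.
Proof. exact: memv_adjoin. Qed.

Lemma K_sub_S : (K <= S)%VS.
Proof. exact: subv_adjoin. Qed.

(** If [omega] were in [K], then A / omega would be a p-th root of [A], as A^p / A^(p-1) = A. *)
Lemma omega_notin : omega \notin K.
Proof.
apply/negP => Kom; apply: A_nonpower.
exists (A / omega); first by rewrite rpred_div ?(mem_integers A_integer).
rewrite expr_div_n omega_root -{1}(subnKC p_gt0) exprS mulfK //.
by rewrite expf_neq0 ?A_neq0.
Qed.

Lemma omega_integer : omega \in integers S.
Proof.
apply: (integers_root p_gt0 omega_mem); rewrite omega_root rpredX //.
have [KA ZA] := integersP _ _ A_integer.
by apply/integersP; split; rewrite ?(subvP K_sub_S).
Qed.

Lemma degree_omega : adjoin_degree K omega = p.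
Proof.
apply: (kummer_degree p_prime zeta_prim zeta_mem _ omega_notin).
by rewrite omega_root rpredX ?(mem_integers A_integer).
Qed.

Lemma dim_S : \dim S = (p * (p - 1))%N.
Proof. by rewrite (dim_Fadjoin K omega) degree_omega dim_cyclotomic. Qed.

Lemma tau_expr_K i : {in K, (tau ^+ i)%g =1 (sigma ^+ i)%g}.
Proof.
have [w [tauK _] _] := tauP; elim: i => [|i IH] x Kx; first by rewrite !expg0 !gal_id.
rewrite !expgSr !galM // ?(subvP K_sub_S) // IH // tauK //.
exact: memv_gal.
Qed.

Lemma tau_expr_omega i :
  exists2 k, cong1 k & (tau ^+ i)%g omega = omega ^+ (mu ^ i %% p) * k.
Proof.
have cA := semi_primary_cong1 A_semi_primary.
(* The unreduced exponent suffices: reducing it mod p costs a power of omega^p = A^(p-1), which is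
   itself 1 mod pi^2. *)
suff [k ck ->] : exists2 k, cong1 k & (tau ^+ i)%g omega = omega ^+ (mu ^ i) * k.
  exists ((A ^+ (p - 1)) ^+ (mu ^ i %/ p) * k).
    by apply: cong1M => //; apply: cong1X.
  by rewrite mulrA -omega_root -exprM -exprD mulnC addnC -divn_eq.
have [w [tauK tau_om] cu] := tauP; elim: i => [|i [k ck IH]].
  by exists 1; [exact: cong1_1 | rewrite expg0 gal_id expr1 mulr1].
exists ((alpha ^+ (p - 1) * zeta ^+ w) ^+ (mu ^ i) * sigma k).
  apply: cong1M; last exact: cong1_gal.
  apply: cong1X; split; first by rewrite rpredM ?rpredX ?zeta_mem.
  exact/val_geE.
rewrite expgSr galM ?omega_mem // IH rmorphM rmorphXn /= tau_om -mulrA.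
by rewrite tauK ?(proj1 ck) // exprMn -exprM -expnS mulrA.
Qed.

Lemma tau_expr_eq1 : (tau ^+ (p - 1))%g = 1%g.
Proof.
have fix_K x : x \in K -> (tau ^+ (p - 1))%g x = x.
  move=> Kx; rewrite tau_expr_K //.
  have /eqP -> : (sigma ^+ (p - 1))%g == 1%g by rewrite gal_expr_eq1.
  by rewrite gal_id.
have in_gal (s : gal_of S) : {in K, forall x, s x = x} -> s \in 'Gal(S / K)%g.
  by move=> sK; rewrite gal_kHom ?K_sub_S //; apply/kAHomP.
apply/eqP; rewrite (gal_adjoin_eq (in_gal _ fix_K) (group1 _)) gal_id.
have [k ck Dk] := tau_expr_omega (p - 1).
have mu_p : (mu ^ (p - 1) %% p = 1)%N.
  rewrite subn1 -(totient_prime p_prime) Euler_exp_totient ?modn_small //.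
  rewrite coprime_sym prime_coprime // gtnNdvd //; first by case/andP: mu_range.
  by case/andP: mu_range => _; rewrite subn1 -ltnS prednK.
rewrite mu_p expr1 in Dk.
(* omega^p lies in [K], so it is fixed; comparing p-th powers makes [k] a p-th root of unity. *)
have kp1 : k ^+ p = 1.
  apply: (mulfI (expf_neq0 p omega_neq0)); rewrite mulr1 -exprMn -Dk -rmorphXn /=.
  by rewrite omega_root fix_K // rpredX ?(mem_integers A_integer).
have [j Dj] := prim_rootP zeta_prim kp1.
rewrite Dj in ck; have := cong1_zeta ck.
by rewrite Dk Dj /dvdn modn_small // => /eqP ->; rewrite expr0 mulr1.
Qed.

(** The order is at least that of the restriction to [K], which is [sigma]. *)
Lemma tau_order : #[tau]%g = (p - 1)%N.
Proof.
apply/eqP; rewrite eqn_dvd order_dvdn tau_expr_eq1 eqxx /=.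
by rewrite -gal_zeta_fix -tau_expr_K ?zeta_mem // expg_order gal_id.
Qed.

(** * The element Omega and the field it generates *)

Local Notation Omega := (\sum_(0 <= i < p - 1) (tau ^+ i)%g omega).

Lemma Omega_integer : Omega \in integers S.
Proof.
by rewrite rpred_sum // => i _; apply: integers_gal; apply: omega_integer.
Qed.

Lemma Omega_fixed : tau Omega = Omega.
Proof.
rewrite rmorph_sum /= -(prednK (n := p - 1)) ?subn_gt0 //.
rewrite big_nat_recr // [RHS]big_nat_recl //= addrC; congr (_ + _).
  rewrite -galM ?omega_mem // -expgSr prednK ?subn_gt0 //.
  by rewrite tau_expr_eq1.
by apply: eq_bigr => i _; rewrite -galM ?omega_mem // -expgSr.
Qed.

Lemma Omega_notin : Omega \notin K.
Proof.
apply/negP => KOm.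
pose k i := (tau ^+ i)%g omega / omega ^+ (mu ^ i %% p).
have tauE i : (tau ^+ i)%g omega = omega ^+ (mu ^ i %% p) * k i.
  by rewrite mulrC divfK // expf_neq0 ?omega_neq0.
have ck i : cong1 (k i).
  have [k' ck' Dk'] := tau_expr_omega i.
  by rewrite /k Dk' mulrC mulKf // expf_neq0 ?omega_neq0.
(* If Omega is in [K], [q] has coefficients in [K], degree below p, and root [omega]; hence it
   vanishes, the degree of [omega] over [K] being p. *)
pose q := \sum_(i < p - 1) k i *: 'X^(mu ^ i %% p) - Omega%:P.
have Kq : q \is a polyOver K.
  rewrite rpredB ?polyOverC // rpred_sum // => i _.
  by rewrite polyOverZ ?rpredX ?polyOverX ?(proj1 (ck i)).
have szq : (size q <= adjoin_degree K omega)%N.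
  rewrite degree_omega; apply/leq_sizeP => j le_pj.
  rewrite coefB coefC gtn_eqF ?(leq_trans p_gt0) // subr0 coef_sum big1 // => i _.
  by rewrite coefZ coefXn gtn_eqF ?mulr0 // (leq_trans _ le_pj) ?ltn_pmod.
have q0 : q = 0.
  apply/eqP; rewrite -(root_small_adjoin_poly Kq szq) rootE /q !hornerE.
  rewrite big_mkord horner_sum subr_eq0; apply/eqP/eq_bigr => i _.
  by rewrite !hornerE tauE mulrC.
(* The constant term Omega does not touch the coefficient at index 1, which collects the [k i] with
   mu^i = 1 mod p. *)
have := congr1 (fun f : {poly L} => f`_1) q0.
rewrite coef0 coefB coefC /= subr0 coef_sum.
rewrite (eq_bigr (fun i : 'I_(p - 1) => if (mu ^ i %% p == 1)%N then k i else 0)).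
  rewrite -big_mkcond /=; apply/eqP/cong1_sum_neq0 => //.
  have lt0 : (0 < p - 1)%N by rewrite subn_gt0.
  apply/andP; split.
    (* The index i = 0 always contributes. *)
    by apply/card_gt0P; exists (Ordinal lt0); rewrite unfold_in /= expn0 modn_small.
  apply: (leq_ltn_trans (max_card _)).
  by rewrite card_ord subn1 ltn_predL.
by move=> i _; rewrite coefZ coefXn eq_sym; case: eqP; rewrite ?mulr1 ?mulr0.
Qed.

Lemma Omega_degree (M : {subfield L} := <<1; Omega>>%AS) :
  [/\ (M <= S)%VS, \dim M = p & \dim_M S = (p - 1)%N].
Proof.
have sFS := fixedField_bound <[tau]>%g.
have dimF : \dim (fixedField <[tau]>%g) = p.
  have := dim_fixedField <[tau]>%G; rewrite -[#|_|]/#[tau]%g tau_order => DF.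
  have := dim_sup_field sFS; rewrite -DF dim_S mulnC => /eqP.
  by rewrite eqn_pmul2l ?subn_gt0 // => /eqP.
have sMF : (M <= fixedField <[tau]>%g)%VS.
  rewrite sub_adjoin1v; apply/fixedFieldP.
    exact: mem_integers Omega_integer.
  move=> _ /cycleP[i ->]; elim: i => [|i IH]; first by rewrite expg0 gal_id.
  by rewrite expgSr galM ?(mem_integers Omega_integer) // IH Omega_fixed.
have sMS := subv_trans sMF sFS.
have dimM : \dim M = p.
  (* The dimension divides the prime p; dimension 1 would make Omega rational and put it in [K]. *)
  have := field_dimS sMF; rewrite dimF => /(prime_nt_dvdP p_prime) -> //.
  apply: contra Omega_notin => /eqP dimM1.
  have M1 : (1%VS : {vspace L}) = M by apply/eqP; rewrite eqEdim dimv1 dimM1 sub1v.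
  apply: (subvP (sub1v K)); rewrite M1; exact: memv_adjoin.
split=> //; rewrite dim_S dimM mulKn //.
Qed.

End KummerExtension.

End Cyclotomic.

Theorem theorem4p5 (L : splittingFieldType rat) (iota : {rmorphism L -> algC})
  (p : nat) (p_prime : prime p) (p_odd : odd p)
  (zeta : L) (zeta_prim : p.-primitive_root zeta)
  (v : nat) (v_prim : (p - 1)%N.-primitive_root (v%:R : 'F_p))
  (sigma : gal_of (cyclotomic_field zeta)) (sigma_zeta : sigma zeta = zeta ^+ v)
  (mu : nat) (mu_range : (1 <= mu <= p - 1)%N) (A alpha : L)
  (data : [\/ negative_data iota p v sigma mu A alpha,
              positive_data iota p v sigma mu A alpha
            | unit_data iota p v sigma mu A alpha])
  (omega : L) (omega_root : omega ^+ p = A ^+ (p - 1))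
  (sigma_mu : gal_of (S_field zeta omega))
  (sigma_muP : is_sigma_mu p sigma mu alpha sigma_mu) :
  let S := S_field zeta omega in
  let Omega := \sum_(0 <= i < p - 1) (sigma_mu ^+ i)%g omega in
  let M : {subfield L} := <<1; Omega>>%AS in
  [/\ ring_of_integers S Omega,
      (M <= S)%VS,
      \dim M = p,
      \dim_M S = (p - 1)%N
    & sigma_mu Omega = Omega].
Proof.
have [A_int A_nonpow A_sp Kalpha] : [/\ A \in integers (cyclotomic_field zeta),
    not_pth_power (cyclotomic_field zeta) p A, semi_primary zeta A
    & alpha \in cyclotomic_field zeta].
  (* Each kind of data yields the four facts used above; a unit [A] is integral by definition, and
     its [alpha], a real unit, lies in [K]. *)
  case: data => [[m [Gamma [I [a D]]]]|[m [Gamma [I [a D]]]]|[m [a D]]].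
  - have [? ? _] := cd_singular D.
    by split; [exact/integersP | | exact: cd_semi_primary D | exact: cd_alpha D].
  - have [? ? _] := cd_singular D.
    by split; [exact/integersP | | exact: cd_semi_primary D | exact: cd_alpha D].
  - have [_ _ ? _] := ud_unit D; have [_ [? _] _ _] := ud_alpha D.
    by split; [exact/integersP | exact: ud_not_power D
              | exact: ud_semi_primary D | ].
move=> S Omega M.
have [sMS dimM dimS] := Omega_degree iota p_prime p_odd zeta_prim v_prim
  sigma_zeta mu_range A_int A_nonpow A_sp Kalpha omega_root sigma_muP.
split=> //.
  exact/integersP/(Omega_integer p_prime A_int omega_root).
exact: (Omega_fixed iota p_prime p_odd zeta_prim v_prim sigma_zeta mu_range
  A_int A_nonpow A_sp Kalpha omega_root sigma_muP).
Qed.
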